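(* Let $k,N\ge 1$ be integers and let $X_1,\dots,X_k$ be pairwise disjoint finite nonempty sets with $|X_i|=n_i$. Let $\mathrm{EC}(N)$ be the set of eventually $N$-cyclic $k$-tuples $(f_1,\dots,f_k)$ of functions $f_i:X_i\to X_{i+1}$ (indices modulo $k$). Then $$\#\mathrm{EC}(N)=\frac1N\prod_{i=1}^k n_i^{\,n_{i-1}-(N+1)}\frac{n_i!}{(n_i-N)!}\left(\prod_{j=1}^k n_j-\prod_{j=1}^k(n_j-N)\right).$$
   Context: Indices are modulo $k$, so $X_{k+1}=X_1$ and $n_0=n_k$. A $k$-tuple $(f_1,\dots,f_k)$ with $f_i:X_i\to X_{i+1}$ is eventually $N$-cyclic if the iterated images $(f_k\cdots f_1)^m(X_1)$ of the composition $f_k\cdots f_1:X_1\to X_1$ eventually stabilize (for large $m$) to a subset of $X_1$ of cardinality $N$ on which $f_k\cdots f_1$ acts as an $N$-cycle (a single cyclic permutation of all $N$ elements). The quotient $n!/(n-N)!$ denotes the falling factorial $n(n-1)\cdots(n-N+1)$, which is $0$ when $n<N$. The product $\prod_{i=1}^k$ covers both factors $n_i^{n_{i-1}-(N+1)}$ and $n_i!/(n_i-N)!$; the final parenthesis is outside this product. Negative exponents are read in the rational numbers. *)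

(* Defs.v *)
From mathcomp Require Import all_boot all_order all_algebra.
From mathcomp Require Import boolp.

Set Implicit Arguments.
Unset Strict Implicit.
Unset Printing Implicit Defensive.

Import GRing.Theory.
Local Open Scope ring_scope.

Lemma val_iter_ordS (k m : nat) (i : 'I_k) :
  iter m (@ordS k) i = ((i + m) %% k)%N :> nat.
Proof.
elim: m => [|m IHm]; first by rewrite addn0 modn_small.
by rewrite iterS /= IHm addnS -addn1 modnDml addn1.
Qed.

Lemma iter_ordS_k (k : nat) (i : 'I_k) : iter k (@ordS k) i = i.
Proof. by apply: val_inj; rewrite /= val_iter_ordS modnDr modn_small. Qed.

(* Indices live in 'I_k, starting at 0, with cyclic successor ordS and
   cyclic predecessor ord_pred. *)
Notation cyclic_tuple X := {dffun forall i, {ffun X i -> X (ordS i)}}.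

Section EventuallyCyclic.

Variables (k : nat) (X : 'I_k -> finType) (f : cyclic_tuple X) (i : 'I_k).

Fixpoint compn (m : nat) : X i -> X (iter m (@ordS k) i) :=
  if m is m'.+1 then fun x => f (iter m' (@ordS k) i) (compn m' x) else id.

(* Going once around the index cycle brings the index back to i only up to the
   propositional equality iter_ordS_k, whence the cast. *)
Definition comp_around (x : X i) : X i :=
  ecast j (X j) (iter_ordS_k i) (compn k x).

Definition acts_as_cycle (S : finType) (g : S -> S) (A : {set S}) (N : nat) :=
  exists c : seq S, [/\ size c = N, ufcycle g c & A = [set x in c]].

Definition eventually_cyclic (N : nat) : Prop :=
  exists A : {set X i},
    [/\ exists M : nat, forall m : nat, (M <= m)%N ->
          [set iter m comp_around x | x : X i] = A,
        #|A| = N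
      & acts_as_cycle comp_around A N].

End EventuallyCyclic.

Definition EC (k : nat) (X : 'I_k -> finType) (i : 'I_k) (N : nat) :
    {set cyclic_tuple X} :=
  [set f : cyclic_tuple X | `[< eventually_cyclic f i N >]].

(* Main.v *)
(* Glue the X_i into one coloured set Y and a tuple into a colour-raising map F of
   Y; the tuple is eventually N-cyclic iff some x of colour 0 satisfies F^(kN) x = x,
   has N distinct iterates under F^k, and is reached from every point.  Such an F
   has exactly N such x, so N * #EC counts pairs (x, F), that is, pairs of an
   injective coloured cycle h through x (there are prod n_i^_N of them) and a map F
   that follows h and has no cycle off h.

   For the latter, let B have m_i points of colour i, R be disjoint from B, and
   n_i = #(R + B)_i.  Among the colour-raising maps B -> R + B, a proportion
   prod m_i / n_i has a cycle in B.  Induct on the size of B: with L the preimage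
   of R, cycles avoid L, and the restriction to B - L takes values in L + (B - L).
   Writing prod m_i as the number of transversals of the colour classes turns the
   induction step into the expansion of a product of sums over subsets. *)
Require Import Defs.
From mathcomp Require Import all_boot all_order all_algebra.
From mathcomp Require Import boolp ring.

Set Implicit Arguments.
Unset Strict Implicit.
Unset Printing Implicit Defensive.

Import GRing.Theory.
Local Open Scope nat_scope.

(** * Counting maps with prescribed target sets *)

Lemma card_family_prod (I J : finType) (F : I -> {set J}) :
  #|family F| = \prod_(i : I) #|F i|.
Proof. by rewrite card_family foldrE big_image. Qed.

(** As [P] only sees values on [D], maps are grouped by their restriction to [D], extended by the
    identity; in each group the values off [D] are free. *)
Lemma card_family_restrict (Y : finType) (F : Y -> {set Y}) (D : {set Y})
    (P : pred {ffun Y -> Y}) :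
    (forall f g : {ffun Y -> Y}, {in D, f =1 g} -> P f = P g) ->
  #|[set f in family F | P f]| =
    (\prod_(y in ~: D) #|F y|) *
    #|[set f in family (fun y => if y \in D then F y else [set y]) | P f]|.
Proof.
move=> Ploc; rewrite -!sum1_card big_distrr /=.
pose r (f : {ffun Y -> Y}) := [ffun y => if y \in D then f y else y].
have Pr f : P (r f) = P f by apply: Ploc => y yD; rewrite ffunE yD.
rewrite (partition_big r
  [in [set f in family (fun y => if y \in D then F y else [set y]) | P f]]) /=.
  apply: eq_bigr => g; rewrite inE => /andP[/familyP gF Pg].
  rewrite muln1 sum1_card.
  transitivity #|family (fun y => if y \in D then [set g y] else F y)|.
    apply: eq_card => f; rewrite [f \in _]inE inE.
    apply/andP/familyP=> [[/andP[/familyP fF Pf] /eqP <-] y|fF].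
      by rewrite /r ffunE; case: (y \in D); rewrite ?set11.
    have rf : r f = g.
      apply/ffunP => y; rewrite ffunE; have := fF y; have := gF y.
      by case: (y \in D) => [_|+ _]; rewrite inE => /eqP ->.
    split; last exact/eqP.
    rewrite -Pr rf Pg andbT; apply/familyP => y; have := fF y; have := gF y.
    by case: (y \in D) => //; rewrite inE => + /eqP ->.
  rewrite card_family_prod [RHS]big_mkcond; apply: eq_bigr => y _.
  by rewrite inE; case: (y \in D); rewrite ?cards1.
move=> f; rewrite !inE => /andP[/familyP fF Pf]; rewrite Pr Pf andbT.
by apply/familyP => y; rewrite ffunE; case: ifP; rewrite ?inE.
Qed.

(** Expansion of the product of sums: [L] collects the points where [r] is picked. Extending [r] by
    0 off [E] kills the subsets not inside [E]. *)
Lemma sum_subset_prod (Y : finType) (E : {set Y}) (r m : Y -> nat) :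
  \sum_(L : {set Y} | L \subset E)
     (\prod_(y in L) r y) * (\prod_(y in E :\: L) m y) =
  \prod_(y in E) (r y + m y).
Proof.
pose F y := if y \in E then r y else 0; pose G y := if y \in E then m y else 1.
transitivity (\prod_y (F y + G y)); last first.
  by rewrite [RHS]big_mkcond; apply: eq_bigr => y _; rewrite /F /G; case: ifP.
rewrite bigA_distr [RHS](bigID (fun L : {set Y} => L \subset E)) /=.
rewrite [X in _ = _ + X]big1 ?addn0.
  apply: eq_big => [//|L LE]; rewrite [X in X * _]big_mkcond.
  rewrite [X in _ * X]big_mkcond -big_split; apply: eq_bigr => y _ /=.
  rewrite inE /F /G; have := subsetP LE y.
  by case: (y \in L) => /= [->|_] //; rewrite ?muln1 // mul1n.
move=> L /subsetPn[y yL yE].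
by rewrite (bigD1 y) //= yL /F (negPf yE).
Qed.

(** * Colour classes and transversals *)

Definition layer (Y : finType) (k : nat) (col : Y -> 'I_k) (U : {set Y})
    (i : 'I_k) : {set Y} :=
  [set y in U | col y == i].

Definition transversals (Y : finType) (k : nat) (col : Y -> 'I_k) (B : {set Y}) :=
  family (layer col B) : pred {ffun 'I_k -> Y}.

Lemma prod_layers (Y : finType) (k : nat) (col : Y -> 'I_k) (B : {set Y})
    (w : 'I_k -> nat) :
  \prod_(y in B) w (col y) = \prod_(i < k) w i ^ #|layer col B i|.
Proof.
rewrite (partition_big col predT) //=; apply: eq_bigr => i _.
rewrite -prod_nat_const; apply: eq_big => [y|y /andP[_ /eqP ->]] //.
by rewrite inE.
Qed.

Lemma transversalsP (Y : finType) (k : nat) (col : Y -> 'I_k) (B : {set Y})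
    (b : {ffun 'I_k -> Y}) :
  reflect (forall i, b i \in B /\ col (b i) = i) (b \in transversals col B).
Proof.
apply: (iffP familyP) => bP i; have := bP i.
  by rewrite inE => /andP[? /eqP].
by rewrite inE => -[-> ->] /=.
Qed.

Lemma prod_transversal (Y : finType) (k : nat) (col : Y -> 'I_k) (B : {set Y})
    (b : {ffun 'I_k -> Y}) (w : 'I_k -> nat) : b \in transversals col B ->
  (\prod_(i < k) w i) * (\prod_(y in B :\: b @: 'I_k) w (col y)) =
  \prod_(y in B) w (col y).
Proof.
move=> /transversalsP bP; have binj : injective b.
  by move=> i j bij; have [_ <-] := bP i; have [_ <-] := bP j; rewrite bij.
rewrite [RHS](big_setID (b @: 'I_k)) /=; congr (_ * _).
rewrite (setIidPr _); last by apply/subsetP => _ /imsetP[i _ ->]; case: (bP i).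
rewrite big_imset /=; last by move=> i j _ _; apply: binj.
by apply: eq_bigr => i _; have [_ ->] := bP i.
Qed.

(** A transversal uses one factor [w i] per colour, so the factor in front completes each summand to
    the full product over [B]. *)
Lemma sum_transversals (Y : finType) (k : nat) (col : Y -> 'I_k) (B : {set Y})
    (w : 'I_k -> nat) :
  (\prod_(i < k) w i) *
    (\sum_(b in transversals col B) \prod_(y in B :\: b @: 'I_k) w (col y)) =
  (\prod_(i < k) #|layer col B i|) * \prod_(y in B) w (col y).
Proof.
rewrite big_distrr -card_family_prod -sum_nat_const /=.
by apply: eq_bigr => b bB; rewrite prod_transversal.
Qed.

(** * Colour-raising maps with a cycle in a given set *)

(** On a finite set, a nonempty stable subset of [B] exists exactly when [f] has a cycle inside [B];
    this form involves no length or ordering. *)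
Definition has_closed (Y : finType) (f : {ffun Y -> Y}) (B : {set Y}) :=
  [exists S : {set Y}, [&& S != set0, S \subset B & f @: S \subset S]].

(* The maps sending [B] into [U] one colour up; off [B] they are the identity,
   so that they are determined by their restriction to [B]. *)
Definition colmap (Y : finType) (k : nat) (col : Y -> 'I_k) (U B : {set Y}) :=
  fun y => if y \in B then layer col U (ordS (col y)) else [set y].

Lemma has_closed_local (Y : finType) (B : {set Y}) (f g : {ffun Y -> Y}) :
  {in B, f =1 g} -> has_closed f B = has_closed g B.
Proof.
move=> fg; apply: eq_existsb => S; case SB: (S \subset B); rewrite ?andbF //.
suff -> : f @: S = g @: S by [].
by apply: eq_in_imset => y yS; apply/fg/(subsetP SB).
Qed.

(** A nonempty [B] is itself closed, so all maps from [B] to [B] count. Their number is given by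
    [sum_transversals] if every colour occurs in [B]; otherwise both sides are zero. *)
Lemma card_closed_stable (Y : finType) (k : nat) (k_gt0 : 0 < k)
    (col : Y -> 'I_k) (B : {set Y}) :
  #|[set f in family (colmap col B B) | has_closed f B]| =
  \sum_(b in transversals col B)
     \prod_(y in B :\: b @: 'I_k) #|layer col B (ordS (col y))|.
Proof.
have [B0|Bn0] := eqVneq B set0.
  rewrite [LHS]eq_card0 ?big_pred0 // => f.
    apply/negP => /transversalsP/(_ (Ordinal k_gt0))[].
    by rewrite B0 inE.
  rewrite B0; apply/negP; rewrite inE => /andP[_ /existsP[S /and3P[Sn0]]].
  by rewrite subset0 (negPf Sn0).
have -> : #|[set f in family (colmap col B B) | has_closed f B]| =
          \prod_(y in B) #|layer col B (ordS (col y))|.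
  transitivity #|family (colmap col B B)|.
    apply: eq_card => f; rewrite [LHS]inE; case: familyP => //= fB.
    apply/existsP; exists B; rewrite Bn0 subxx /=.
    apply/subsetP => _ /imsetP[y yB ->]; have := fB y.
    by rewrite /colmap yB inE => /andP[].
  rewrite card_family_prod [RHS]big_mkcond; apply: eq_bigr => y _.
  by rewrite /colmap; case: ifP; rewrite ?cards1.
have [/existsP[i0 /eqP Bi0]|] := boolP [exists i, #|layer col B i| == 0].
  rewrite [RHS]big_pred0; last first.
    move=> b; apply/negP => /transversalsP/(_ i0)[biB bi].
    by have := card0_eq Bi0 (b i0); rewrite !inE biB bi eqxx.
  (* Walking through the colours from an occurring one to the missing [i0], one meets an occurring
     colour whose successor is missing; its points have no possible image. *)
  have [y yB By] : exists2 y, y \in B & #|layer col B (ordS (col y))| == 0.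
    apply/exists_inP; apply: contraT; rewrite negb_exists_in => /forall_inP Bpos.
    have [y0 y0B] := set0Pn _ Bn0.
    have Bm m : #|layer col B (iter m (@ordS k) (col y0))| != 0.
      elim: m => [|m]; first by apply/eqP => /cards0_eq/setP/(_ y0);
        rewrite !inE y0B eqxx.
      rewrite cards_eq0 => /set0Pn[z]; rewrite inE iterS => /andP[zB /eqP <-].
      exact: Bpos.
    have := Bm (i0 + (k - col y0)).
    suff -> : iter (i0 + (k - col y0)) (@ordS k) (col y0) = i0.
      by rewrite Bi0.
    apply: val_inj; rewrite /= val_iter_ordS addnCA subnKC; last exact: ltnW.
    by rewrite modnDr modn_small.
  by rewrite (bigD1 y) //= (eqP By).
rewrite negb_exists => /forallP Bpos.
(* With [w i] the size of the next layer, the two products over the colours differ by a cyclic shift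
   and are positive, so they cancel. *)
have := sum_transversals col B (fun i => #|layer col B (ordS i)|).
have -> : \prod_(i < k) #|layer col B (ordS i)| = \prod_(i < k) #|layer col B i|.
  by rewrite [RHS](reindex_inj (@ordS_inj k)).
move/eqP; rewrite eqn_pmul2l ?prodn_gt0 // => [/eqP //|i].
by rewrite lt0n Bpos.
Qed.

Lemma closed_avoids (Y : finType) (R B : {set Y}) (f : {ffun Y -> Y}) :
  [disjoint R & B] -> has_closed f B = has_closed f (B :\: [set y in B | f y \in R]).
Proof.
move=> RB; apply/existsP/existsP => -[S /and3P[Sn0 SB Sf]]; exists S.
  rewrite Sn0 Sf andbT; apply/subsetP => y yS; rewrite !inE (subsetP SB) //= andbT.
  apply/negP => fyR; have /(subsetP Sf) fyS : f y \in f @: S by apply: imset_f.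
  by have := disjointFr RB fyR; rewrite (subsetP SB).
by rewrite Sn0 Sf andbT (subset_trans SB) // subsetDl.
Qed.

(** When all colours occur in [R :|: B], [sum_transversals] turns the right-hand side into the
    proportion prod m_i / n_i of all maps. *)
Lemma card_closed (Y : finType) (k : nat) (k_gt0 : 0 < k) (col : Y -> 'I_k)
    (R B : {set Y}) : [disjoint R & B] ->
  #|[set f in family (colmap col (R :|: B) B) | has_closed f B]| =
  \sum_(b in transversals col B)
     \prod_(y in B :\: b @: 'I_k) #|layer col (R :|: B) (ordS (col y))|.
Proof.
have [n] := ubnP #|B|; elim: n => // n IHn in R B *; rewrite ltnS => Bn RB.
pose L (f : {ffun Y -> Y}) := [set y in B | f y \in R].
rewrite -sum1_card (partition_big L (fun A => A \subset B)) /=; last first.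
  by move=> f _; apply/subsetP => y; rewrite inE => /andP[].
(* For a fixed preimage [A] of [R], points of [A] take any value in [R] of the next colour; the
   others map into [B], that is, [A] together with [B :\: A], and only they can carry a closed
   set. *)
have step (A : {set Y}) : A \subset B ->
    \sum_(f in [set f in family (colmap col (R :|: B) B) | has_closed f B]
         | L f == A) 1
  = (\prod_(y in A) #|layer col R (ordS (col y))|) *
    \sum_(b in transversals col (B :\: A)) \prod_(y in (B :\: b @: 'I_k) :\: A)
      #|layer col B (ordS (col y))|.
  move=> AB; rewrite sum1_card.
  have BA : A :|: (B :\: A) = B by rewrite -{1}(setIidPr AB) setID.
  pose F y := if y \in A then layer col R (ordS (col y)) else
              colmap col B B y.
  have -> : #|[pred f in [set f in family (colmap col (R :|: B) B)
                               | has_closed f B] | L f == A]|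
     = #|[set f in family F | has_closed f (B :\: A)]|.
    apply: eq_card => f; rewrite [LHS]inE [X in X && _]inE [RHS]inE /=.
    have -> : (f \in family F) = (f \in family (colmap col (R :|: B) B)) && (L f == A).
      apply/familyP/andP => [fF|[/familyP fF /eqP LA] y].
        split.
          apply/familyP => y; have := fF y; rewrite /F /colmap.
          have := subsetP AB y.
          case: (y \in A) => [->|_] //; first by rewrite !inE => /andP[-> ->].
          by case: (y \in B) => //; rewrite !inE => /andP[-> ->]; rewrite orbT.
        apply/eqP/setP => y; rewrite inE; have := fF y; rewrite /F /colmap.
          have := subsetP AB y.
        case: (y \in A) => [->|_] //; first by rewrite !inE => /andP[-> _].
        by case: (y \in B) => //; rewrite !inE => /andP[yB _]; rewrite (disjointFl RB).
      have := fF y; rewrite /F /colmap -LA inE; case: (y \in B) => //=.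
      by rewrite !inE; case: ifP => fyR; rewrite !inE ?fyR.
    rewrite andbAC; case: (boolP (L f == A)) => [/eqP <-|]; last by rewrite !andbF.
    by rewrite (closed_avoids f RB).
  rewrite (card_family_restrict _ (@has_closed_local Y (B :\: A))).
  congr (_ * _).
    rewrite big_mkcond [RHS]big_mkcond; apply: eq_bigr => y _.
    rewrite !inE /F /colmap; case: (boolP (y \in A)) => //= yA.
    by case: (y \in B) => //=; rewrite cards1.
  transitivity #|[set f in family (colmap col (A :|: (B :\: A)) (B :\: A)) |
                   has_closed f (B :\: A)]|.
    apply: eq_card => f; rewrite 2!inE; congr (_ && _).
    apply/familyP/familyP => fF y; have := fF y; rewrite /F /colmap BA inE;
      by case: (y \in A) => //; case: (y \in B).
  have -> : \sum_(b in transversals col (B :\: A)) \prod_(y in (B :\: b @: 'I_k) :\: A)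
      #|layer col B (ordS (col y))| =
      \sum_(b in transversals col (B :\: A)) \prod_(y in (B :\: A) :\: b @: 'I_k)
      #|layer col (A :|: (B :\: A)) (ordS (col y))|.
    by rewrite BA; apply: eq_bigr => b _; rewrite !setDDl setUC.
  (* With [A] empty the set does not shrink and induction does not apply, but the maps then stay
     inside [B]. *)
  have [->|An0] := eqVneq A set0.
    by rewrite setD0 set0U card_closed_stable.
  apply: IHn; last by rewrite -setI_eq0 setIDA setDIl setDv set0I.
  apply: leq_trans Bn; rewrite -(cardsID A B) (setIidPr AB) -[X in X < _]add0n ltn_add2r.
  by rewrite card_gt0.
rewrite (eq_bigr _ step).
under eq_bigr do rewrite big_distrr /=.
(* For a fixed transversal [b] of [B], the admissible [A] are the subsets of [B] that miss the image
   of [b]. *)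
rewrite (exchange_big_dep (fun b => b \in transversals col B)) /=; last first.
  move=> A b AB /transversalsP bA; apply/transversalsP => i; have [] := bA i.
  by rewrite inE => /andP[].
apply: eq_bigr => b /transversalsP bB.
(* Each layer of [R :|: B] splits into its parts in [R] and in [B]; the sum over [A] expands the
   product of these sums. *)
rewrite (eq_bigr (fun y => #|layer col R (ordS (col y))| + #|layer col B (ordS (col y))|)).
  rewrite -sum_subset_prod; apply: eq_bigl => A.
  rewrite subsetD; congr (_ && _).
  apply/transversalsP/idP => [bA|AbI i].
    rewrite disjoint_sym -setI_eq0 -subset0; apply/subsetP => y.
    rewrite inE => /andP[/imsetP[i _ ->]].
    by have [] := bA i; rewrite inE => /andP[/negPf ->].
  have [biB bi] := bB i; split=> //; rewrite inE biB andbT.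
  by rewrite (disjointFl AbI) ?imset_f.
move=> y _; rewrite -cardsUI [X in _ = _ + X]eq_card0 ?addn0.
  by apply: eq_card => z; rewrite !inE andb_orl.
move=> z; rewrite !inE; apply/negP => /andP[/andP[zR _] /andP[]].
by rewrite (disjointFr RB).
Qed.

(** * Maps that follow a given coloured cycle *)

Definition loop_parts (Y : finType) (k N : nat) (col : Y -> 'I_k) (i : 'I_k) :
    {set {ffun 'I_N -> Y}} :=
  [set g in ffun_on (layer col setT i) | injectiveb g].

(* A cycle through N points of each of the k colours is encoded by [h], with
   [h i a] its point of colour [i] on lap [a]; the last colour leads to the next
   lap. *)
Definition loop_next (k N : nat) (p : 'I_k * 'I_N) : 'I_k * 'I_N :=
  (ordS p.1, if p.1.+1 == k then ordS p.2 else p.2).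

Definition follows (Y : finType) (k N : nat) (f : {ffun Y -> Y})
    (h : {ffun 'I_k -> {ffun 'I_N -> Y}}) :=
  [forall p, f (h p.1 p.2) == h (loop_next p).1 (loop_next p).2].

Definition loop_support (Y : finType) (k N : nat)
    (h : {ffun 'I_k -> {ffun 'I_N -> Y}}) : {set Y} :=
  [set h p.1 p.2 | p : 'I_k * 'I_N].

Lemma loop_partsP (Y : finType) (k N : nat) (col : Y -> 'I_k)
    (h : {ffun 'I_k -> {ffun 'I_N -> Y}}) :
  reflect ((forall i a, col (h i a) = i) /\ forall i, injective (h i))
          (h \in family (loop_parts N col)).
Proof.
apply: (iffP familyP) => [hP|[hcol hinj] i].
  split=> i; have := hP i; rewrite inE => /andP[/ffun_onP hi /injectiveP //].
  by move=> _ a; have := hi a; rewrite !inE => /andP[_ /eqP].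
rewrite inE; apply/andP; split; last exact/injectiveP.
by apply/ffun_onP => a; rewrite !inE hcol eqxx.
Qed.

Lemma card_loops (Y : finType) (k N : nat) (col : Y -> 'I_k) :
  #|family (loop_parts N col)| = \prod_(i < k) #|layer col setT i| ^_ N.
Proof.
rewrite card_family_prod; apply: eq_bigr => i _.
by rewrite card_inj_ffuns_on card_ord.
Qed.

Lemma card_layer_support (Y : finType) (k N : nat) (col : Y -> 'I_k)
    (h : {ffun 'I_k -> {ffun 'I_N -> Y}}) (i : 'I_k) :
    h \in family (loop_parts N col) ->
  #|layer col (~: loop_support h) i| = #|layer col setT i| - N.
Proof.
move=> /loop_partsP[hcol hinj].
have -> : layer col (~: loop_support h) i = layer col setT i :\: h i @: 'I_N.
  apply/setP => y; rewrite !inE /=; case: eqP => [<-|]; rewrite ?andbF ?andbT //.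
  congr (~~ _); apply/imsetP/imsetP => [[[j a] _ ->]|[a _ ->]].
    by exists a; rewrite //= hcol.
  by exists (col y, a).
rewrite cardsD (setIidPr _) ?card_imset ?card_ord //.
by apply/subsetP => _ /imsetP[a _ ->]; rewrite !inE hcol eqxx.
Qed.

(** Only the values off the cycle are free, where colour [i] has [n i - N] points. This gives [P]
    choices, and [card_closed] counts those with a cycle off [h]; they are added on the left to
    avoid a subtraction. *)
Lemma card_following (Y : finType) (k N : nat) (k_gt0 : 0 < k)
    (col : Y -> 'I_k) (h : {ffun 'I_k -> {ffun 'I_N -> Y}}) :
    h \in family (loop_parts N col) ->
    let n i := #|layer col setT i| in
    let P := \prod_(i < k) n (ordS i) ^ (n i - N) in
  (\prod_(i < k) n i) *
    #|[set f in family (colmap col setT setT) |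
        follows f h && ~~ has_closed f (~: loop_support h)]|
  + (\prod_(i < k) (n i - N)) * P = (\prod_(i < k) n i) * P.
Proof.
move=> hloop n P; have [hcol hinj] := loop_partsP _ _ hloop.
set D := ~: loop_support h.
have hpinj : injective (fun p : 'I_k * 'I_N => h p.1 p.2).
  move=> [i a] [j b] /= hab; have eij : i = j by rewrite -(hcol i a) hab hcol.
  by move: hab; rewrite eij => /hinj ->.
have hsupp p : h p.1 p.2 \in loop_support h by apply/imsetP; exists p.
(* Successor along [h]; the default [y] only makes the function total. *)
pose nexth y := if [pick p | h p.1 p.2 == y] is Some p
                then h (loop_next p).1 (loop_next p).2 else y.
have nexthE p : nexth (h p.1 p.2) = h (loop_next p).1 (loop_next p).2.
  rewrite /nexth; case: pickP => [q /eqP/hpinj -> //|/(_ p)].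
  by rewrite eqxx.
pose G y := if y \in D then layer col setT (ordS (col y)) else [set nexth y].
have -> : #|[set f in family (colmap col setT setT) |
              follows f h && ~~ has_closed f D]|
        = #|[set f in family G | ~~ has_closed f D]|.
  apply: eq_card => f; rewrite [LHS]inE [RHS]inE andbA; congr (_ && _).
  apply/andP/familyP => [[/familyP fcol /forallP fh] y|fG].
    have := fcol y; rewrite /G /colmap inE; case: ifP => // yD _.
    have /imsetP[p _ ->] : y \in loop_support h by move/negbT: yD; rewrite inE negbK.
    by rewrite nexthE inE.
  have fh p : f (h p.1 p.2) = h (loop_next p).1 (loop_next p).2.
    have := fG (h p.1 p.2); rewrite /G inE hsupp /= inE => /eqP ->.
    exact: nexthE.
  split; last by apply/forallP => p; rewrite fh.
  apply/familyP => y; rewrite /colmap inE.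
  have := fG y; rewrite /G; case: ifP => // yD _.
  have /imsetP[p _ ->] : y \in loop_support h by move/negbT: yD; rewrite inE negbK.
  by rewrite fh !inE !hcol eqxx.
have closed_loc (f g : {ffun Y -> Y}) : {in D, f =1 g} ->
    ~~ has_closed f D = ~~ has_closed g D.
  by move=> /has_closed_local ->.
rewrite (card_family_restrict _ closed_loc).
have -> : \prod_(y in ~: D) #|G y| = 1.
  by apply: big1 => y; rewrite inE /G => /negPf ->; rewrite cards1.
rewrite mul1n.
have suppD : loop_support h :|: D = setT by rewrite setUCr.
pose E := family (colmap col setT D).
have -> : #|[set f in family (fun y => if y \in D then G y else [set y]) |
              ~~ has_closed f D]|
        = #|[set f in E | ~~ has_closed f D]|.
  apply: eq_card => f; rewrite [LHS]inE [RHS]inE; congr (_ && _).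
  by apply/familyP/familyP => fE y; have := fE y; rewrite /colmap /G; case: (y \in D).
have PE : P = \prod_(y in D) n (ordS (col y)).
  rewrite (prod_layers col D (fun i => n (ordS i))); apply: eq_bigr => i _.
  by rewrite card_layer_support.
have cardE : #|E| = P.
  rewrite card_family_prod PE [RHS]big_mkcond; apply: eq_bigr => y _.
  by rewrite /colmap; case: ifP; rewrite ?cards1.
have closedE : (\prod_(i < k) n i) * #|[set f in E | has_closed f D]|
             = (\prod_(i < k) (n i - N)) * P.
  have disj : [disjoint loop_support h & D] by rewrite -setI_eq0 setICr.
  have := card_closed k_gt0 col disj; rewrite suppD => ->.
  have -> : \prod_(i < k) n i = \prod_(i < k) n (ordS i).
    by rewrite [LHS](reindex_inj (@ordS_inj k)).
  rewrite (sum_transversals col D (fun i => n (ordS i))) -PE; congr (_ * _).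
  by apply: eq_bigr => i _; rewrite card_layer_support.
rewrite -closedE -mulnDr -cardE; congr (_ * _).
rewrite -!sum1dep_card -sum1_card addnC.
by rewrite [RHS](bigID (fun f => has_closed f D)).
Qed.

(** * Points on the unique cycle of a map *)

(** If no iterate of [y] lies in [U], the forward orbit of [y] is closed and avoids [U]; conversely
    a closed set off [U] traps its orbits. *)
Lemma has_closedPn (Y : finType) (F : {ffun Y -> Y}) (U : {set Y}) :
  reflect (forall y, exists m, iter m F y \in U) (~~ has_closed F (~: U)).
Proof.
apply: (iffP existsPn) => [noS y|reach S]; last first.
  apply/negP => /and3P[/set0Pn[y yS] /subsetP SU /subsetP FS].
  have [m] := reach y; suff /SU : iter m F y \in S by rewrite inE => /negPf ->.
  by elim: m => //= m IHm; apply/FS/imset_f.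
case: (boolP [exists z, fconnect F y z && (z \in U)]).
  by move=> /existsP[z /andP[/iter_findex <- zU]]; exists (findex F y z).
rewrite negb_exists => /forallP noU.
have /negP[] := noS [set z | fconnect F y z]; apply/and3P; split.
- by apply/set0Pn; exists y; rewrite inE connect0.
- by apply/subsetP => z; rewrite !inE => yz; have := noU z; rewrite yz.
- apply/subsetP => _ /imsetP[z + ->]; rewrite !inE => yz.
  exact: connect_trans yz (fconnect1 _ _).
Qed.

(** Possible starting points of the cycle in colour [i]: [iter k F] is one turn around the colours,
    and the last condition says that every orbit of [F] reaches [x]. *)
Definition cycle_points (Y : finType) (k N : nat) (col : Y -> 'I_k) (i : 'I_k)
    (F : {ffun Y -> Y}) : {set Y} :=
  [set x | [&& col x == i, iter N (iter k F) x == x,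
               uniq (traject (iter k F) x N) & ~~ has_closed F (~: [set x])]].

Lemma cycle_pointsP (Y : finType) (k N : nat) (col : Y -> 'I_k) (i : 'I_k)
    (F : {ffun Y -> Y}) (x : Y) :
  reflect [/\ col x = i, iter N (iter k F) x = x,
              uniq (traject (iter k F) x N) & forall y, exists m, iter m F y = x]
          (x \in cycle_points N col i F).
Proof.
rewrite inE; apply: (iffP and4P) => -[].
  move=> /eqP ? /eqP ? ? /has_closedPn reach; split=> // y.
  by have [m /set1P] := reach y; exists m.
move=> /eqP ? /eqP ? ? reach; split=> //; apply/has_closedPn => y.
by have [m <-] := reach y; exists m; rewrite inE.
Qed.

Lemma col_iter (Y : Type) (k : nat) (col : Y -> 'I_k) (F : Y -> Y) (m : nat)
    (y : Y) : (forall y, col (F y) = ordS (col y)) ->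
  col (iter m F y) = iter m (@ordS k) (col y).
Proof. by move=> colF; elim: m => //= m IHm; rewrite colF IHm. Qed.

Lemma col_iter_dvd (Y : Type) (k : nat) (col : Y -> 'I_k) (F : Y -> Y) (m : nat)
    (y : Y) : (forall y, col (F y) = ordS (col y)) ->
  col (iter m F y) = col y -> k %| m.
Proof.
move=> colF; rewrite (col_iter _ _ colF) => /(congr1 val).
rewrite /= val_iter_ordS -[RHS](modn_small (ltn_ord _)) => /eqP.
by rewrite -[X in _ == X %[mod k]]addn0 eqn_modDl mod0n.
Qed.

Lemma fcycle_traject (T : eqType) (g : T -> T) (x : T) (N : nat) : 0 < N ->
  fcycle g (traject g x N) = (iter N g x == x).
Proof.
case: N => // n _; rewrite trajectS /= rcons_path fpath_traject /=.
by rewrite last_traject.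
Qed.

(** Another such point is an iterate of [x], and equal colours make the number of steps a multiple
    of [k]. Conversely, the points of the trajectory inherit the properties of [x]. *)
Lemma cycle_points_traject (Y : finType) (k N : nat) (N_gt0 : 0 < N)
    (col : Y -> 'I_k) (i : 'I_k) (F : {ffun Y -> Y}) (x : Y) :
    (forall y, col (F y) = ordS (col y)) -> x \in cycle_points N col i F ->
  cycle_points N col i F =i traject (iter k F) x N.
Proof.
move=> colF /cycle_pointsP[colx xN Ux xreach]; set g := iter k F in xN Ux *.
have fc : fcycle g (traject g x N) by rewrite fcycle_traject // xN.
have xin : x \in traject g x N by case: (N) N_gt0 => //= n _; apply: mem_head.
have mem m : iter m g x \in traject g x N.
  by apply: loopingP; rewrite /looping xN.
move=> y; apply/cycle_pointsP/idP => [[coly yN Uy yreach]|/trajectP[m mN ->]].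
  have [m xy] := yreach x; have /dvdnP[q mq] : k %| m.
    by apply: (@col_iter_dvd _ _ col F m x colF); rewrite xy colx coly.
  by rewrite -xy mq iterM.
split.
- rewrite -iterM (col_iter _ _ colF) colx; apply: val_inj.
  by rewrite /= val_iter_ordS addnC modnMDl modn_small.
- by rewrite -!iterD addnC iterD xN.
- have := order_cycle fc Ux (mem m); rewrite size_traject => <-.
  exact: orbit_uniq.
move=> z; have [m' <-] := xreach z; exists (m * k + m').
by rewrite iterD -iterM.
Qed.

Lemma card_cycle_points (Y : finType) (k N : nat) (N_gt0 : 0 < N) (col : Y -> 'I_k)
    (i : 'I_k) (F : {ffun Y -> Y}) (x : Y) :
    (forall y, col (F y) = ordS (col y)) -> x \in cycle_points N col i F ->
  #|cycle_points N col i F| = N.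
Proof.
move=> colF xr; have /cycle_pointsP[_ _ Ux _] := xr.
by rewrite (eq_card (cycle_points_traject N_gt0 colF xr)) (card_uniqP Ux) size_traject.
Qed.

(** * Cycles followed by a map and their starting points *)

Section Followers.

Variables (Y : finType) (k N : nat) (k_gt0 : 0 < k) (N_gt0 : 0 < N).
Variables (col : Y -> 'I_k) (F : {ffun Y -> Y}).
Hypothesis colF : forall y, col (F y) = ordS (col y).

Let i0 := Ordinal k_gt0.
Let a0 := Ordinal N_gt0.
Let g := iter k F.

Lemma iter_follows (h : {ffun 'I_k -> {ffun 'I_N -> Y}}) (i : 'I_k) (a : 'I_N) :
  follows F h -> iter i F (h i0 a) = h i a.
Proof.
move=> /forallP fh; case: i; elim=> [|j IHj] jk /=.
  by congr (h _ a); apply: val_inj.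
rewrite (IHj (ltnW jk)) (eqP (fh (Ordinal (ltnW jk), a))) /=.
rewrite (ltn_eqF jk); congr (h _ a); apply: val_inj => /=.
by rewrite modn_small.
Qed.

Lemma iter_around_follows (h : {ffun 'I_k -> {ffun 'I_N -> Y}}) (m : nat) :
  follows F h -> iter m g (h i0 a0) = h i0 (iter m (@ordS N) a0).
Proof.
move=> fh; elim: m => //= m ->; set a := iter m _ _.
have k1 : k.-1 < k by rewrite prednK.
have -> z : g z = F (iter k.-1 F z) by rewrite -iterS prednK.
rewrite (iter_follows (Ordinal k1) a fh) (eqP (forallP fh (Ordinal k1, a))) /=.
rewrite prednK // eqxx; congr (h _ _); apply: val_inj => /=.
by rewrite prednK // modnn.
Qed.

Lemma iter_a0 (a : 'I_N) : iter a (@ordS N) a0 = a.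
Proof. by apply: val_inj; rewrite /= val_iter_ordS add0n modn_small. Qed.

(** Given [F], the starting point determines all of [h]; hence the injectivity in
    [card_followers]. *)
Lemma follows_iter (h : {ffun 'I_k -> {ffun 'I_N -> Y}}) (i : 'I_k) (a : 'I_N) :
  follows F h -> h i a = iter i F (iter a g (h i0 a0)).
Proof.
by move=> fh; rewrite (iter_around_follows a fh) iter_a0 iter_follows.
Qed.

(** The bijection sends [h] to its first point [h i0 a0]; the inverse records the orbit of a cycle
    point lap by lap. *)
Lemma card_followers :
  #|[set h : {ffun 'I_k -> {ffun 'I_N -> Y}} in family (loop_parts N col) |
      follows F h && ~~ has_closed F (~: loop_support h)]| = #|cycle_points N col i0 F|.
Proof.
set H := [set h in _ | _]; pose start (h : {ffun 'I_k -> {ffun 'I_N -> Y}}) := h i0 a0.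
rewrite -(@card_in_imset _ _ start) => [|h1 h2]; last first.
  rewrite !inE => /and3P[_ f1 _] /and3P[_ f2 _] e12.
  apply/ffunP => i; apply/ffunP => a.
  by rewrite (follows_iter i a f1) (follows_iter i a f2) -/(start h1) e12.
have start_root (h : {ffun 'I_k -> {ffun 'I_N -> Y}}) : h \in H ->
    start h \in cycle_points N col i0 F.
  rewrite inE => /and3P[/loop_partsP[hcol hinj] fh /has_closedPn reach].
  apply/cycle_pointsP.
  have hN : iter N g (start h) = start h.
    rewrite (iter_around_follows N fh) (_ : iter N _ a0 = a0) //.
    by apply: val_inj; rewrite /= val_iter_ordS modnn.
  split=> //; first exact: hcol.
    have -> : traject (iter k F) (start h) N = [seq h i0 a | a <- enum 'I_N].
      apply: (@eq_from_nth _ (start h)).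
        by rewrite size_traject size_map size_enum_ord.
      move=> j; rewrite size_traject => jN.
      rewrite nth_traject // (nth_map a0) ?size_enum_ord //.
      rewrite (iter_around_follows j fh) -[j in LHS]/(val (Ordinal jN)) iter_a0.
      rewrite (_ : nth a0 _ j = Ordinal jN) //.
      by apply: val_inj; rewrite /= nth_enum_ord.
    by rewrite map_inj_uniq ?enum_uniq //; apply: hinj.
  move=> y; have [m /imsetP[[i a] _ /= mia]] := reach y.
  (* From [h i a], [k - i] steps complete the lap and [N - a.+1] further laps lead back to the
     start. *)
  exists ((k - i) + (N - a.+1) * k + m); rewrite iterD mia.
  rewrite (follows_iter i a fh) -(iterD _ i) -iterM -iterD.
  have -> : k - i + (N - a.+1) * k + i + a * k = N * k.
    rewrite [_ + _ + i]addnAC subnK ?(ltnW (ltn_ord i)) // -mulSn subnSK //.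
    by rewrite -mulnDl subnK ?(ltnW (ltn_ord a)).
  by rewrite iterM.
apply: eq_card => x; apply/imsetP/idP => [[h hH ->]|].
  exact: start_root.
move=> /cycle_pointsP[colx xN Ux xreach].
pose h := [ffun i : 'I_k => [ffun a : 'I_N => iter i F (iter a g x)]].
have hE i a : h i a = iter i F (iter a g x) by rewrite !ffunE.
exists h; last by rewrite /start hE.
rewrite inE; apply/and3P; split.
- apply/loop_partsP; split=> [i a|i a b].
    rewrite hE -iterM -iterD (col_iter _ _ colF) colx; apply: val_inj.
    by rewrite /= val_iter_ordS add0n addnC modnMDl modn_small.
  (* The remaining [k - i] steps push both points to the end of their laps; [N.-1] more laps give
     back the starts of laps [a] and [b]. *)
  rewrite !hE => /(congr1 (iter (k - i) F)); rewrite -!iterD subnK ?(ltnW (ltn_ord i)) //.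
  rewrite -/g -!iterS => e; apply: val_inj => /=.
  have {}e : iter a g x = iter b g x.
    have := congr1 (iter N.-1 g) e; rewrite -!iterD !addnS -!addSn prednK //.
    by rewrite addnC iterD xN addnC iterD xN.
  apply/eqP; rewrite -(nth_uniq x _ _ Ux) ?size_traject //.
  by rewrite !nth_traject // e.
- apply/forallP => -[i a]; rewrite !hE /=; apply/eqP.
  have [ik|ik] := eqVneq i.+1 k.
    have -> : i.+1 %% k = 0 by rewrite ik modnn.
    rewrite -iterS ik -/g /= -iterS.
    have [aN|aN] := eqVneq a.+1 N; first by rewrite aN modnn xN.
    by rewrite modn_small // ltn_neqAle aN /=.
  by rewrite modn_small // ltn_neqAle ik /=.
apply/has_closedPn => y; have [m ymx] := xreach y; exists m.
by apply/imsetP; exists (i0, a0) => //=; rewrite hE.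
Qed.

End Followers.

(** * Gluing the sets into one coloured set *)

Definition total_space (k : nat) (X : 'I_k -> finType) : finType := {i : 'I_k & X i}.

Definition inj_total (k : nat) (X : 'I_k -> finType) (i : 'I_k) (x : X i) :
    total_space X :=
  Tagged (fun i => X i : Type) x.

Definition colour (k : nat) (X : 'I_k -> finType) (y : total_space X) : 'I_k := tag y.

Definition glue (k : nat) (X : 'I_k -> finType) (f : cyclic_tuple X) :
    {ffun total_space X -> total_space X} :=
  [ffun y : total_space X => inj_total (f (tag y) (tagged y))].

Lemma inj_total_inj (k : nat) (X : 'I_k -> finType) (i : 'I_k) :
  injective (@inj_total k X i).
Proof. by move=> x y /eqP; rewrite eq_Tagged => /eqP. Qed.

Lemma colour_glue (k : nat) (X : 'I_k -> finType) (f : cyclic_tuple X)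
    (y : total_space X) : colour (glue f y) = ordS (colour y).
Proof. by rewrite ffunE. Qed.

Lemma card_colour (k : nat) (X : 'I_k -> finType) (i : 'I_k) :
  #|layer (@colour k X) setT i| = #|X i|.
Proof.
rewrite -(card_imset _ (@inj_total_inj k X i)).
apply: eq_card => y; rewrite !inE /=; apply/eqP/imsetP => [|[x _ ->] //].
by case: y => j x /= <-; exists x.
Qed.

Lemma glue_inj (k : nat) (X : 'I_k -> finType) : injective (@glue k X).
Proof.
move=> f f' eff'; apply/ffunP => i; apply/ffunP => x; apply: (@inj_total_inj k X).
by have /ffunP/(_ (inj_total x)) := eff'; rewrite !ffunE.
Qed.

Lemma glue_onto (k : nat) (X : 'I_k -> finType)
    (F : {ffun total_space X -> total_space X}) :
  F \in family (colmap (@colour k X) setT setT) -> exists f, F = glue f.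
Proof.
move=> /familyP Fcol.
have Fcast i (x : X i) : exists z : X (ordS i), F (inj_total x) = inj_total z.
  have := Fcol (inj_total x); rewrite /colmap !inE /= => /eqP.
  by case: (F _) => j z /= ej; subst j; exists z.
have [f Ff] := fin_all_exists (fun i => fin_all_exists (Fcast i)).
exists [ffun i => [ffun x => f i x]]; apply/ffunP => -[i x].
by rewrite !ffunE /= -Ff.
Qed.

(** In the disjoint union the cast of [comp_around] disappears, since transport along an equality of
    indices does not change the tagged element. *)
Lemma inj_total_comp_around (k : nat) (X : 'I_k -> finType) (f : cyclic_tuple X)
    (i : 'I_k) (m : nat) (x : X i) :
  inj_total (iter m (@comp_around k X f i) x) = iter m (iter k (glue f)) (inj_total x).
Proof.
elim: m => //= m <-; move: (iter m _ x) => {}x; rewrite /comp_around.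
have compnE n : iter n (glue f) (inj_total x) = inj_total (compn f n x).
  by elim: n => //= n ->; rewrite ffunE.
rewrite compnE.
have castE (j j' : 'I_k) (e : j = j') (z : X j) :
    inj_total (ecast j (X j) e z) = inj_total z by case: _ / e.
exact: castE.
Qed.

Lemma map_traject_total (k : nat) (X : 'I_k -> finType) (f : cyclic_tuple X)
    (i : 'I_k) (x : X i) (N : nat) :
  map (@inj_total k X i) (traject (@comp_around k X f i) x N) =
  traject (iter k (glue f)) (inj_total x) N.
Proof.
elim: N x => //= N IHN x; rewrite IHN; congr (_ :: traject _ _ _).
exact: (inj_total_comp_around f 1 x).
Qed.

(** A point of the eventual cycle is reached by every orbit after enough turns; conversely, the
    trajectory of a cycle point under [comp_around] is the stable image. *)
Lemma eventually_cyclicP (k N : nat) (X : 'I_k -> finType) (k_gt0 : 0 < k)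
    (N_gt0 : 0 < N) (f : cyclic_tuple X) (i := Ordinal k_gt0) :
  eventually_cyclic f i N <-> exists x, x \in cycle_points N (@colour k X) i (glue f).
Proof.
set F := glue f; set g := iter k F; set G := @comp_around k X f i.
have GE m x : inj_total (iter m G x) = iter m g (inj_total x).
  exact: inj_total_comp_around.
have dvd_i m (x : X i) : colour (iter m F (inj_total x)) = i -> k %| m.
  exact: (@col_iter_dvd _ _ (@colour k X) F m (inj_total x) (colour_glue f)).
split=> [[A [[M AM] _ [c [cN /andP[fc Uc] Ac]]]]|[y /cycle_pointsP[]]].
  case: c => [|x p] in cN fc Uc Ac; first by rewrite -cN in N_gt0.
  have cE : x :: p = traject G x N.
    have /andP[_ /fpathE ep] : (G (last x p) == x) && fpath G x p.
      by have := fc; rewrite (cycle_path x).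
    by rewrite ep -cN.
  exists (inj_total x); apply/cycle_pointsP; rewrite cE in fc Uc Ac.
  have xN : iter N G x = x by apply/eqP; rewrite -fcycle_traject.
  split=> //; first by rewrite -GE xN.
    by rewrite -map_traject_total map_inj_uniq //; apply: inj_total_inj.
  (* The path from [y] to [x]: steps to colour 0, [M] turns into the stable set, then [N - a] turns
     along the cycle. *)
  move=> y; set z := iter (k - colour y) F y.
  have cz : colour z = i.
    rewrite (col_iter _ _ (colour_glue f)); apply: val_inj.
    by rewrite /= val_iter_ordS subnKC ?modnn // ltnW.
  have [z' zz'] : exists z' : X i, z = inj_total z'.
    by case: z cz => j z' /= ej; subst j; exists z'.
  have : iter M G z' \in A by rewrite -(AM M (leqnn M)) imset_f.
  rewrite Ac inE => /trajectP[a aN ea].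
  exists ((N - a) * k + (M * k + (k - colour y))).
  rewrite !iterD -/z zz' !iterM -GE -GE ea -iterD subnK ?xN //.
  exact: ltnW.
case: y => j x /= ej; subst j; rewrite -/(inj_total x) => xN Ux reach.
have {}xN : iter N G x = x by apply: (@inj_total_inj k X i); rewrite GE.
have {}Ux : uniq (traject G x N).
  by rewrite -(map_inj_uniq (@inj_total_inj k X i)) map_traject_total.
have [m mx] := fin_all_exists reach.
have mem a : iter a G x \in traject G x N.
  by apply: loopingP; rewrite /looping xN; case: (N) N_gt0 => //= n _; apply: mem_head.
exists [set z in traject G x N]; split; last 1 first.
- exists (traject G x N); split=> //; first by rewrite size_traject.
  by rewrite /ucycle fcycle_traject // xN eqxx.
(* The largest number of steps to [x] also bounds the number of turns, as a turn has at least one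
   step. *)
- exists (\max_(z : X i) m (inj_total z)) => M leM.
  apply/setP => u; rewrite inE; apply/imsetP/trajectP => [[z _ ->]|[a aN ->]].
    set mz := m (inj_total z).
    have emz : iter mz F (inj_total z) = inj_total x by apply: mx.
    have /dvdnP[q mq] : k %| mz by apply: (dvd_i mz z); rewrite emz.
    have qM : q <= M.
      apply: leq_trans leM; apply: leq_trans (leq_bigmax z); rewrite -/mz mq.
      by rewrite leq_pmulr.
    have qx : iter q G z = x.
      by apply: (@inj_total_inj k X i); rewrite GE -emz mq iterM.
    by apply/trajectP; rewrite -(subnK qM) iterD qx.
  have xM q : iter (q * N) G x = x by elim: q => // q IHq; rewrite mulSn iterD IHq.
  (* After [M] more turns the exponent is [a + M * N], and multiples of [N] fix [x]. *)
  exists (iter (a + M * N.-1) G x) => //.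
  by rewrite -iterD addnCA -mulnS prednK // iterD xM.
by rewrite cardsE (card_uniqP Ux) size_traject.
Qed.

(** * Double counting and the final formula *)

(** Eventually cyclic tuples have exactly [N] cycle points and other tuples none. Exchanging the
    sums over maps and cycles, each cycle contributes the count of [card_following]. *)
Lemma card_eventually_cyclic (k N : nat) (X : 'I_k -> finType) (k_gt0 : 0 < k)
    (N_gt0 : 0 < N) :
  let n i := #|X i| in let P := \prod_(i < k) n (ordS i) ^ (n i - N) in
  (\prod_(i < k) n i) * (N * #|EC X (Ordinal k_gt0) N|)
  + (\prod_(i < k) n i ^_ N) * ((\prod_(i < k) (n i - N)) * P) =
  (\prod_(i < k) n i) * ((\prod_(i < k) n i ^_ N) * P).
Proof.
move=> n P; set i0 := Ordinal k_gt0.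
pose H := family (loop_parts N (@colour k X)).
pose good F (h : {ffun 'I_k -> {ffun 'I_N -> total_space X}}) :=
  follows F h && ~~ has_closed F (~: loop_support h).
pose C := family (colmap (@colour k X) setT setT).
have ECE : N * #|EC X i0 N| =
    \sum_(h in H) #|[set F in C | good F h]|.
  transitivity (\sum_(f : cyclic_tuple X) #|cycle_points N (@colour k X) i0 (glue f)|).
    rewrite mulnC -sum_nat_const [LHS]big_mkcond; apply: eq_bigr => f _.
    rewrite inE; case: asboolP => /(eventually_cyclicP k_gt0 N_gt0).
      by case=> x xr; rewrite (card_cycle_points N_gt0 (colour_glue f) xr).
    by move=> nox; rewrite eq_card0 // => x; apply/negP => xr; apply: nox; exists x.
  transitivity (\sum_(F in C) #|cycle_points N (@colour k X) i0 F|).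
    rewrite -(big_imset (fun F => #|cycle_points N (@colour k X) i0 F|)) /=; last first.
      by move=> f f' _ _; apply: glue_inj.
    apply: eq_bigl => F; apply/imsetP/idP => [[f _ ->]|/glue_onto[f ->]]; last by exists f.
    by apply/familyP => y; rewrite /colmap !inE colour_glue eqxx.
  transitivity (\sum_(F in C) \sum_(h in H | good F h) 1).
    apply: eq_bigr => F /glue_onto[f ->].
    by rewrite sum1dep_card -(card_followers k_gt0 N_gt0 (colour_glue f)).
  rewrite (exchange_big_dep (mem H)) /= => [|F h _ /andP[]//].
  by apply: eq_bigr => h hH; rewrite -sum1dep_card; apply: eq_bigl => F; rewrite hH.
have per_h h : h \in H ->
    (\prod_(i < k) n i) * #|[set F in C | good F h]| + (\prod_(i < k) (n i - N)) * P
    = (\prod_(i < k) n i) * P.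
  move=> hH; have := card_following k_gt0 hH; cbv zeta.
  have prodE (w : 'I_k -> nat -> nat) :
      \prod_(i < k) w i #|layer (@colour k X) setT i| = \prod_(i < k) w i (n i).
    by apply: eq_bigr => i _; rewrite card_colour.
  rewrite (prodE (fun _ m => m)) (prodE (fun _ m => m - N)).
  have -> : \prod_(i < k) #|layer (@colour k X) setT (ordS i)| ^
             (#|layer (@colour k X) setT i| - N) = P.
    by apply: eq_bigr => i _; rewrite !card_colour.
  by [].
have cardH : #|H| = \prod_(i < k) n i ^_ N.
  by rewrite card_loops; apply: eq_bigr => i _; rewrite card_colour.
rewrite ECE -cardH big_distrr /= -sum_nat_const -big_split /=.
rewrite (eq_bigr _ per_h) sum_nat_const; exact: mulnCA.
Qed.

Local Open Scope ring_scope.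

Theorem proposition1p4 (k N : nat) (k_gt0 : (0 < k)%N) (N_gt0 : (0 < N)%N)
    (T : finType) (X : 'I_k -> {set T})
    (X_disjoint : forall i j : 'I_k, i != j -> [disjoint X i & X j])
    (X_nonempty : forall i : 'I_k, X i != set0)
    (n : 'I_k -> nat) (n_card : forall i : 'I_k, #|X i| = n i) :
  #|EC (fun i : 'I_k => {x : T | x \in X i} : finType) (Ordinal k_gt0) N|%:R =
    1 / N%:R
    * (\prod_(i < k) ((n i)%:R ^ ((n (ord_pred i))%:Z - N.+1%:Z)
                      * (n i ^_ N)%:R))
    * (\prod_(j < k) (n j)%:R - \prod_(j < k) ((n j)%:R - N%:R)) :> rat.
Proof.
have n_neq0 i : (n i)%:R != 0 :> rat.
  by rewrite Num.Theory.pnatr_eq0 -n_card cards_eq0.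
have N_neq0 : N%:R != 0 :> rat by rewrite Num.Theory.pnatr_eq0 -lt0n.
have := card_eventually_cyclic (fun i => {x : T | x \in X i} : finType) k_gt0 N_gt0.
cbv zeta; set E := #|EC _ _ _|.
have cX i : #|{: {x : T | x \in X i}}| = n i by rewrite card_sig -n_card.
have prodE (w : 'I_k -> nat -> nat) :
    (\prod_(i < k) w i #|{: {x : T | x \in X i}}| = \prod_(i < k) w i (n i))%N.
  by apply: eq_bigr => i _; rewrite cX.
rewrite (prodE (fun _ m => m)) (prodE (fun _ m => m ^_ N)%N).
rewrite (prodE (fun _ m => m - N)%N).
have -> : (\prod_(i < k) #|{: {x : T | x \in X (ordS i)}}| ^
             (#|{: {x : T | x \in X i}}| - N) =
           \prod_(i < k) n i ^ (n (ord_pred i) - N))%N.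
  rewrite (reindex_inj (@ord_pred_inj k)); apply: eq_bigr => i _.
  by rewrite !cX ord_predK.
move/(congr1 (fun m => m%:R : rat)); rewrite natrD !natrM !natr_prod => count.
have prod_n_neq0 : \prod_(i < k) (n i)%:R != 0 :> rat.
  by apply/prodf_neq0 => i _.
(* If some [n i] is below [N], natural and rational subtraction differ, but the falling factorial
   makes both sides vanish. *)
have [/existsP[i ltiN]|] := boolP [exists i, (n i < N)%N].
  have ff0 : \prod_(i < k) (n i ^_ N)%:R = 0 :> rat.
    by rewrite (bigD1 i) //= ffact_small // mulr0n mul0r.
  rewrite big_split /= ff0 !(mulr0, mul0r).
  move/eqP: count; rewrite ff0 !(mul0r, mulr0) addr0 !mulf_eq0.
  by rewrite (negPf prod_n_neq0) (negPf N_neq0) => /eqP.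
rewrite negb_exists => /forallP leNn; have {}leNn i : (N <= n i)%N by rewrite leqNgt.
have -> : \prod_(j < k) ((n j)%:R - N%:R) = \prod_(j < k) (n j - N)%:R :> rat.
  by apply: eq_bigr => j _; rewrite natrB.
rewrite big_split /=.
(* The exponent splits into the natural number [n (ord_pred i) - N] and -1, which yields the
   denominator. *)
have -> : \prod_(i < k) (n i)%:R ^ ((n (ord_pred i))%:Z - N.+1%:Z) =
    \prod_(i < k) (n i ^ (n (ord_pred i) - N))%:R / \prod_(i < k) (n i)%:R :> rat.
  rewrite -prodf_div; apply: eq_bigr => i _.
  rewrite -addn1 PoszD opprD addrA subzn // expfzDr //.
  by rewrite natrX.
apply: (mulfI N_neq0); apply: (mulfI prod_n_neq0).
(* Adding and removing the second summand of [count] makes its left side appear. *)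
rewrite -[LHS](addrK (\prod_(i < k) (n i ^_ N)%:R *
  (\prod_(i < k) (n i - N)%:R * \prod_(i < k) (n i ^ (n (ord_pred i) - N))%:R))).
rewrite count; field.
by rewrite N_neq0 prod_n_neq0.
Qed.
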